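(* For each braid $\sigma\in B_4$ there exists $n\in\mathbb{N}$ such that the following holds. (1) The entries $\rho_{11}(a^n\sigma)$ and $\rho_{31}(a^n\sigma)$ of the Burau matrix $\rho(a^n\sigma)$ can be decomposed by means of three Laurent polynomials $P,Q,R\in\mathbb{Z}[t,t^{-1}]$ as $$\rho_{11}(a^n\sigma)=P\,(1-t^{-1})+Q+R\,(1-t),\qquad \rho_{31}(a^n\sigma)=-P-Q-R,$$ such that (2) for each $m\in\mathbb{N}$ $$\rho_{11}(a^{m+n}\sigma)=P\,S_{m+1}(t^{-1})+Q+R\,S_{m+1}(t),$$ $$\rho_{31}(a^{m+n}\sigma)=-P\,S_m(t^{-1})-Q-R\,S_m(t);$$ and the polynomials $P,Q,R$ are uniquely determined by properties (1) and (2). (3) Moreover, if $\sigma$ is a pure braid, then the polynomial $P$ is non-zero.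
   Context: $B_4=\langle \sigma_1,\sigma_2,\sigma_3\mid \sigma_1\sigma_2\sigma_1=\sigma_2\sigma_1\sigma_2,\ \sigma_3\sigma_2\sigma_3=\sigma_2\sigma_3\sigma_2,\ \sigma_3\sigma_1=\sigma_1\sigma_3\rangle$ is the braid group on four strands. A braid is pure if it lies in the kernel of the homomorphism from $B_4$ to the symmetric group on $\{1,2,3,4\}$ sending $\sigma_i$ to the transposition $(i\ i{+}1)$. $\rho:B_4\to GL(3,\mathbb{Z}[t,t^{-1}])$ is the reduced Burau representation (the action of $B_4$ on the first homology of the infinite cyclic cover of the 4-punctured disc, a free $\mathbb{Z}[t,t^{-1}]$-module of rank 3, written in the basis of standard forks). Concretely, it is the group homomorphism given by $$\rho(\sigma_1)=\begin{pmatrix}-t^{-1}&0&0\\ t^{-1}&1&0\\ 0&0&1\end{pmatrix},\quad \rho(\sigma_2)=\begin{pmatrix}1&1&0\\ 0&-t^{-1}&0\\ 0&t^{-1}&1\end{pmatrix},\quad \rho(\sigma_3)=\begin{pmatrix}1&0&0\\ 0&1&1\\ 0&0&-t^{-1}\end{pmatrix}.$$ $\rho_{ij}(\sigma)$ denotes the $(i,j)$ entry of $\rho(\sigma)$. $a=\sigma_1\sigma_2\sigma_1^{-1}\sigma_3\sigma_2^{-1}\sigma_1^{-1}\in B_4$; its image is $$\rho(a)=\begin{pmatrix}-t^{-1}+1&-t^{-1}+t&-t^{-1}\\ 0&-t&0\\ -1&0&0\end{pmatrix}.$$ For an integer $i\ge 0$, $S_i(t)=\sum_{k=0}^{i}(-t)^k$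 and $S_i(t^{-1})=\sum_{k=0}^{i}(-t^{-1})^k$ (for example $S_2(t^{-1})=1-t^{-1}+t^{-2}$). *)

(* Defs.v *)
From HB Require Import structures.
From mathcomp Require Import all_boot all_order all_fingroup all_algebra.
From mathcomp Require Import boolp ring generic_quotient.

Set Implicit Arguments.
Unset Strict Implicit.
Unset Printing Implicit Defensive.

Import GRing.Theory.

Local Open Scope ring_scope.
Local Open Scope quotient_scope.

(* The group presented by generators X and relations u = v, for rel u v.      *)
(* A letter (x, b) stands for x if b is false and for x^-1 if b is true.      *)
Section Presentation.
Variables (X : choiceType) (rel : seq (X * bool) -> seq (X * bool) -> Prop).

Notation word := (seq (X * bool)).

Definition inv_letter (l : X * bool) : X * bool := (l.1, ~~ l.2).

Definition inv_word (w : word) : word := rev (map inv_letter w).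

Inductive word_eq : word -> word -> Prop :=
| weq_rel u v : rel u v -> word_eq u v
| weq_cancel l : word_eq [:: l; inv_letter l] [::]
| weq_refl u : word_eq u u
| weq_sym u v : word_eq u v -> word_eq v u
| weq_trans u v w : word_eq u v -> word_eq v w -> word_eq u w
| weq_cat u u' v v' : word_eq u u' -> word_eq v v' ->
    word_eq (u ++ v) (u' ++ v').

Definition word_eqb (u v : word) : bool := `[< word_eq u v >].

Lemma word_eqb_refl : reflexive word_eqb.
Proof. by move=> u; apply/asboolP; exact: weq_refl. Qed.

Lemma word_eqb_sym : symmetric word_eqb.
Proof. by move=> u v; apply/asboolP/asboolP; exact: weq_sym. Qed.

Lemma word_eqb_trans : transitive word_eqb.
Proof.
by move=> v u w /asboolP uv /asboolP vw; apply/asboolP; exact: weq_trans vw.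
Qed.

Canonical word_equiv :=
  EquivRel word_eqb word_eqb_refl word_eqb_sym word_eqb_trans.

Definition presented := {eq_quot word_equiv}.

HB.instance Definition _ := Choice.on presented.
HB.instance Definition _ : EqQuotient _ word_equiv presented :=
  EqQuotient.on presented.

Definition word_class (w : word) : presented := \pi_presented w.

Lemma word_classP (u v : word) : word_eq u v <-> word_class u = word_class v.
Proof.
by split=> [/asboolP|] uv; [apply/eqquotP|apply/asboolP; move/eqquotP: uv].
Qed.

Lemma repr_word_classK (x : presented) : word_class (repr x) = x.
Proof. exact: reprK. Qed.

Lemma repr_word_class (u : word) : word_eq (repr (word_class u)) u.
Proof. by apply/word_classP; rewrite repr_word_classK. Qed.

Definition presented_mul (x y : presented) : presented :=
  word_class (repr x ++ repr y).

Definition presented_one : presented := word_class [::].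

Definition presented_inv (x : presented) : presented :=
  word_class (inv_word (repr x)).

Definition generator (x : X) : presented := word_class [:: (x, false)].

Lemma inv_letterK : involutive inv_letter.
Proof. by case=> x b; rewrite /inv_letter /= negbK. Qed.

Lemma inv_wordK : involutive inv_word.
Proof. by move=> w; rewrite /inv_word map_rev revK (mapK inv_letterK). Qed.

Lemma cat_inv_word (w : word) : word_eq (w ++ inv_word w) [::].
Proof.
elim: w => [|l w IHw]; first exact: weq_refl.
have -> : (l :: w) ++ inv_word (l :: w) =
          [:: l] ++ (w ++ inv_word w) ++ [:: inv_letter l].
  by rewrite /inv_word /= rev_cons -cats1 catA.
apply: weq_trans (weq_cancel l).
apply: (weq_cat (weq_refl [:: l])).
exact: (weq_cat IHw (weq_refl [:: inv_letter l])).
Qed.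

Lemma presented_mulE (u v : word) :
  presented_mul (word_class u) (word_class v) = word_class (u ++ v).
Proof.
by apply/word_classP; apply: weq_cat; exact: repr_word_class.
Qed.

Lemma presented_mulA : associative presented_mul.
Proof.
move=> x y z; rewrite -[x]repr_word_classK -[y]repr_word_classK -[z]repr_word_classK.
by rewrite !presented_mulE catA.
Qed.

Lemma presented_mul1 : left_id presented_one presented_mul.
Proof. by move=> x; rewrite -[x]repr_word_classK presented_mulE. Qed.

Lemma presented_mulr1 : right_id presented_one presented_mul.
Proof. by move=> x; rewrite -[x]repr_word_classK presented_mulE cats0. Qed.

Lemma presented_mulV :
  left_inverse presented_one presented_inv presented_mul.
Proof.
move=> x; rewrite -[x in presented_mul _ x]repr_word_classK presented_mulE.
apply/word_classP.
by rewrite -{2}[repr x]inv_wordK; exact: cat_inv_word.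
Qed.

Lemma presented_mulrV :
  right_inverse presented_one presented_inv presented_mul.
Proof.
move=> x; rewrite -[x in presented_mul x _]repr_word_classK presented_mulE.
by apply/word_classP; exact: cat_inv_word.
Qed.

HB.instance Definition _ := isGroup.Build presented
  presented_mulA presented_mul1 presented_mulr1 presented_mulV presented_mulrV.

Lemma word_classM (u v : word) :
  (word_class u * word_class v)%g = word_class (u ++ v).
Proof. exact: presented_mulE. Qed.

Lemma generator_word2 (x y : X) :
  word_class [:: (x, false); (y, false)] = (generator x * generator y)%g.
Proof. by rewrite (word_classM [:: _] [:: _]). Qed.

Lemma generator_word3 (x y z : X) :
  word_class [:: (x, false); (y, false); (z, false)] =
  (generator x * generator y * generator z)%g.
Proof. by rewrite -generator_word2 (word_classM [:: _; _] [:: _]). Qed.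

Section Lift.
Variables (G : groupType) (f : X -> G).

Definition eval_letter (l : X * bool) : G :=
  (if l.2 then (f l.1)^-1 else f l.1)%g.

Definition eval_word (w : word) : G :=
  foldr (fun l g => eval_letter l * g)%g 1%g w.

Lemma eval_word_cat (u v : word) :
  eval_word (u ++ v) = (eval_word u * eval_word v)%g.
Proof. by elim: u => [|l u IHu] /=; rewrite ?mul1g // IHu mulgA. Qed.

Definition respects : Prop :=
  forall u v : word, rel u v -> eval_word u = eval_word v.

Hypothesis f_rel : respects.

Lemma eval_word_eq (u v : word) : word_eq u v -> eval_word u = eval_word v.
Proof.
elim=> {u v} [//|[x []]|//|//|u v w _ -> _ -> //|u u' v v' _ Eu _ Ev].
- by rewrite /= /eval_letter /= mulg1 mulVg.
- by rewrite /= /eval_letter /= mulg1 mulgV.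
- by rewrite !eval_word_cat Eu Ev.
Qed.

Definition presented_lift of respects := fun x : presented =>
  eval_word (repr x).

Local Notation lift := (presented_lift f_rel).

Lemma presented_liftE (w : word) : lift (word_class w) = eval_word w.
Proof. by apply: eval_word_eq; exact: repr_word_class. Qed.

Lemma presented_lift_gen (x : X) : lift (generator x) = f x.
Proof. by rewrite presented_liftE /= mulg1. Qed.

Lemma presented_liftM : {morph lift : x y / (x * y)%g}.
Proof.
move=> x y; rewrite -[x]repr_word_classK -[y]repr_word_classK.
by rewrite word_classM !presented_liftE eval_word_cat.
Qed.

Lemma presented_lift1 : lift 1%g = 1%g.
Proof. exact: presented_liftE. Qed.

HB.instance Definition _ :=
  isUMagmaMorphism.Build presented G lift (conj presented_lift1 presented_liftM).

End Lift.
End Presentation.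

(* The indices 1, 2, 3 of generators and of matrix rows and columns.          *)
Definition i1 : 'I_3 := @Ordinal 3 0 isT.
Definition i2 : 'I_3 := @Ordinal 3 1 isT.
Definition i3 : 'I_3 := @Ordinal 3 2 isT.

Inductive braid_rel : seq ('I_3 * bool) -> seq ('I_3 * bool) -> Prop :=
| braid_rel_121 : braid_rel [:: (i1, false); (i2, false); (i1, false)]
                            [:: (i2, false); (i1, false); (i2, false)]
| braid_rel_323 : braid_rel [:: (i3, false); (i2, false); (i3, false)]
                            [:: (i2, false); (i3, false); (i2, false)]
| braid_rel_31 : braid_rel [:: (i3, false); (i1, false)]
                           [:: (i1, false); (i3, false)].

Definition B4 : Type := presented braid_rel.
HB.instance Definition _ := Group.on B4.

Definition sigma (i : 'I_3) : B4 := generator braid_rel i.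

Lemma sigma_121 :
  (sigma i1 * sigma i2 * sigma i1 = sigma i2 * sigma i1 * sigma i2)%g.
Proof.
rewrite -!generator_word3.
by apply/word_classP/weq_rel; constructor.
Qed.

Lemma sigma_323 :
  (sigma i3 * sigma i2 * sigma i3 = sigma i2 * sigma i3 * sigma i2)%g.
Proof.
rewrite -!generator_word3.
by apply/word_classP/weq_rel; constructor.
Qed.

Lemma sigma_31 : (sigma i3 * sigma i1 = sigma i1 * sigma i3)%g.
Proof.
rewrite -!generator_word2.
by apply/word_classP/weq_rel; constructor.
Qed.

Definition adj_tperm (i : 'I_3) : {perm 'I_4} :=
  tperm (widen_ord (leqnSn 3) i) (lift ord0 i).

Lemma adj_tperm_rel : respects braid_rel adj_tperm.
Proof.
move=> u v [] /=; rewrite /eval_letter /= !mulg1; apply/permP => x;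
  rewrite !permM !permE /=; apply/eqP;
  by case: x => [[|[|[|[|//]]]] ?]; do ?rewrite -!val_eqE /=.
Qed.

Definition braid_perm : B4 -> {perm 'I_4} := presented_lift adj_tperm_rel.
HB.instance Definition _ := UMagmaMorphism.on braid_perm.

Lemma braid_perm_sigma (i : 'I_3) : braid_perm (sigma i) = adj_tperm i.
Proof. exact: presented_lift_gen. Qed.

Definition pure (s : B4) : Prop := braid_perm s = 1%g.

(* Z[t,t^-1], as the subring of the fraction field of Z[t] consisting of the  *)
(* fractions p / t^k.                                                         *)
Definition laurent_pred : pred {fraction {poly int}} := fun x =>
  `[< exists (p : {poly int}) (k : nat),
        x = FracField.tofrac p / FracField.tofrac 'X ^+ k >].

Record laurent : Type := Laurent {
  laurent_val : {fraction {poly int}};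
  _ : laurent_pred laurent_val }.

HB.instance Definition _ := [isSub for laurent_val].
HB.instance Definition _ := [Choice of laurent by <:].

Lemma tofracX_neq0 : FracField.tofrac ('X : {poly int}) != 0.
Proof. by rewrite tofrac_eq0 polyX_eq0. Qed.

Lemma laurent_subring_closed : subring_closed laurent_pred.
Proof.
have nz k : FracField.tofrac ('X : {poly int}) ^+ k != 0.
  by rewrite expf_neq0 // tofracX_neq0.
split=> [|x y /asboolP[p [k ->]] /asboolP[q [l ->]]
         |x y /asboolP[p [k ->]] /asboolP[q [l ->]]]; apply/asboolP.
- by exists 1, 0; rewrite tofrac1 expr0 divr1.
- exists (p * 'X^l - q * 'X^k), (k + l)%N.
  by rewrite -mulNr addf_div // mulNr tofracB !tofracM !tofracXn exprD.
- by exists (p * q), (k + l)%N; rewrite tofracM exprD mulf_div.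
Qed.

HB.instance Definition _ :=
  GRing.SubChoice_isSubComNzRing.Build _ laurent_pred laurent
    laurent_subring_closed.

Definition laurent_unit : pred laurent := fun x => `[< exists y, y * x = 1 >].

Definition laurent_inv (x : laurent) : laurent :=
  if laurent_unit x then insubd x (val x)^-1 else x.

Lemma laurent_mulVx : {in laurent_unit, left_inverse 1 laurent_inv *%R}.
Proof.
move=> x ux; have {}ux : laurent_unit x by [].
rewrite /laurent_inv ux; move/asboolP: ux => [y yx]; apply: val_inj.
have yxv : val y * val x = 1 by rewrite -rmorphM yx rmorph1.
have xnz : val x != 0.
  by apply/eqP => x0; move/eqP: yxv; rewrite x0 mulr0 eq_sym oner_eq0.
have -> : (val x)^-1 = val y by rewrite -[LHS]mul1r -yxv mulfK.
by rewrite valKd yx.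
Qed.

Lemma laurent_unitPl (x y : laurent) : y * x = 1 -> laurent_unit x.
Proof. by move=> yx; apply/asboolP; exists y. Qed.

Lemma laurent_inv_out : {in [predC laurent_unit], laurent_inv =1 id}.
Proof.
by move=> x /negbTE ux; rewrite /laurent_inv [laurent_unit x]ux.
Qed.

HB.instance Definition _ := GRing.ComNzRing_hasMulInverse.Build laurent
  laurent_mulVx laurent_unitPl laurent_inv_out.

Lemma laurent_mulf_eq0 : GRing.integral_domain_axiom laurent.
Proof.
move=> x y /(congr1 val); rewrite rmorphM rmorph0 => /eqP.
by rewrite mulf_eq0 -!(rmorph0 (val : laurent -> _)) !(inj_eq val_inj).
Qed.

HB.instance Definition _ :=
  GRing.ComUnitRing_isIntegral.Build laurent laurent_mulf_eq0.

Lemma laurent_t_subproof : laurent_pred (FracField.tofrac 'X).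
Proof. by apply/asboolP; exists 'X, 0; rewrite expr0 divr1. Qed.

Definition t : laurent := Laurent laurent_t_subproof.

Lemma t_unit : t \is a GRing.unit.
Proof.
have tV : laurent_pred (FracField.tofrac 'X)^-1.
  by apply/asboolP; exists 1, 1%N; rewrite tofrac1 expr1 mul1r.
apply: (@laurent_unitPl _ (Laurent tV)); apply: val_inj.
by rewrite rmorphM /= mulVf // tofracX_neq0.
Qed.

Lemma val_tV : val (t^-1) = (FracField.tofrac 'X)^-1.
Proof.
apply: (mulIf tofracX_neq0); rewrite mulVf ?tofracX_neq0 //.
by rewrite -[FracField.tofrac _]/(val t) -rmorphM mulVr ?t_unit ?rmorph1.
Qed.

(* The multiplicative group of units; applied to 'M_3 it is GL(3, -).         *)
Section Units.
Variable R : unitRingType.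

Record units : Type := Units {
  units_val : R;
  _ : units_val \is a GRing.unit }.

HB.instance Definition _ := [isSub for units_val].
HB.instance Definition _ := [Choice of units by <:].

Lemma units_valP (x : units) : units_val x \is a GRing.unit.
Proof. by case: x. Qed.

Lemma units_mul_subproof (x y : units) : units_val x * units_val y \is a GRing.unit.
Proof. by rewrite unitrMl units_valP. Qed.

Lemma units_inv_subproof (x : units) : (units_val x)^-1 \is a GRing.unit.
Proof. by rewrite unitrV units_valP. Qed.

Definition units_mul (x y : units) : units := Units (units_mul_subproof x y).
Definition units_one : units := Units (unitr1 R).
Definition units_inv (x : units) : units := Units (units_inv_subproof x).

Lemma units_mulA : associative units_mul.
Proof. by move=> x y z; apply: val_inj; rewrite /= mulrA. Qed.

Lemma units_mul1 : left_id units_one units_mul.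
Proof. by move=> x; apply: val_inj; rewrite /= mul1r. Qed.

Lemma units_mulr1 : right_id units_one units_mul.
Proof. by move=> x; apply: val_inj; rewrite /= mulr1. Qed.

Lemma units_mulV : left_inverse units_one units_inv units_mul.
Proof. by move=> x; apply: val_inj; rewrite /= mulVr ?units_valP. Qed.

Lemma units_mulrV : right_inverse units_one units_inv units_mul.
Proof. by move=> x; apply: val_inj; rewrite /= mulrV ?units_valP. Qed.

HB.instance Definition _ := isGroup.Build units
  units_mulA units_mul1 units_mulr1 units_mulV units_mulrV.

End Units.

Definition mx3 (rows : seq (seq laurent)) : 'M[laurent]_3 :=
  \matrix_(i, j) (nth [::] rows i)`_j.

Lemma mx3M (a11 a12 a13 a21 a22 a23 a31 a32 a33 b11 b12 b13 b21 b22 b23 b31 b32 b33 : laurent) :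
  mx3 [:: [:: a11; a12; a13];
     [:: a21; a22; a23];
     [:: a31; a32; a33]] *
  mx3 [:: [:: b11; b12; b13];
     [:: b21; b22; b23];
     [:: b31; b32; b33]] =
  mx3 [:: [:: a11 * b11 + a12 * b21 + a13 * b31;
         a11 * b12 + a12 * b22 + a13 * b32;
         a11 * b13 + a12 * b23 + a13 * b33];
     [:: a21 * b11 + a22 * b21 + a23 * b31;
         a21 * b12 + a22 * b22 + a23 * b32;
         a21 * b13 + a22 * b23 + a23 * b33];
     [:: a31 * b11 + a32 * b21 + a33 * b31;
         a31 * b12 + a32 * b22 + a33 * b32;
         a31 * b13 + a32 * b23 + a33 * b33]].
Proof.
apply/matrixP => i j; rewrite !mxE !big_ord_recl big_ord0 !mxE /= addr0 addrA.
by case: i j => [[|[|[|//]]] ?] [[|[|[|//]]] ?].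
Qed.

Lemma mx3_1 : mx3 [:: [:: 1; 0; 0]; [:: 0; 1; 0]; [:: 0; 0; 1]] = 1.
Proof.
apply/matrixP => i j; rewrite !mxE.
by case: i j => [[|[|[|//]]] ?] [[|[|[|//]]] ?].
Qed.

Definition burau_mx (i : 'I_3) : 'M[laurent]_3 :=
  match val i with
  | 0 => mx3 [:: [:: - t^-1; 0; 0];
                 [::   t^-1; 1; 0];
                 [::      0; 0; 1]]
  | 1 => mx3 [:: [:: 1;      1; 0];
                 [:: 0; - t^-1; 0];
                 [:: 0;   t^-1; 1]]
  | _ => mx3 [:: [:: 1; 0;      0];
                 [:: 0; 1;      1];
                 [:: 0; 0; - t^-1]]
  end.

Definition burau_inv_mx (i : 'I_3) : 'M[laurent]_3 :=
  match val i with
  | 0 => mx3 [:: [:: - t; 0; 0];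
                 [::   1; 1; 0];
                 [::   0; 0; 1]]
  | 1 => mx3 [:: [:: 1;   t; 0];
                 [:: 0; - t; 0];
                 [:: 0;   1; 1]]
  | _ => mx3 [:: [:: 1; 0;   0];
                 [:: 0; 1;   t];
                 [:: 0; 0; - t]]
  end.

Lemma burau_mxK (i : 'I_3) : burau_mx i * burau_inv_mx i = 1.
Proof.
have tK : t^-1 * t = 1 by rewrite mulVr ?t_unit.
rewrite -mx3_1; case: i => [[|[|[|//]]] ?];
  rewrite /burau_mx /burau_inv_mx /= mx3M; congr (mx3 _);
  do ![congr (_ :: _)]; rewrite ?mulrNN ?mulrN ?tK; ring.
Qed.

Lemma burau_mx_unit (i : 'I_3) : burau_mx i \is a GRing.unit.
Proof. by have [] := mulmx1_unit (burau_mxK i). Qed.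

Lemma burau_mxV (i : 'I_3) : (burau_mx i)^-1 = burau_inv_mx i.
Proof. by rewrite -[RHS](mulKr (burau_mx_unit i)) burau_mxK mulr1. Qed.

Definition burau_gen (i : 'I_3) : units 'M[laurent]_3 :=
  Units (burau_mx_unit i).

Lemma burau_gen_rel : respects braid_rel burau_gen.
Proof.
move=> u v [] /=; rewrite /eval_letter /= !mulg1; apply: val_inj => /=;
  rewrite /burau_mx /= !mx3M; congr (mx3 _); do ![congr (_ :: _)]; ring.
Qed.

Definition rho : B4 -> units 'M[laurent]_3 := presented_lift burau_gen_rel.
HB.instance Definition _ := UMagmaMorphism.on rho.

Lemma rho_sigma (i : 'I_3) : rho (sigma i) = burau_gen i.
Proof. exact: presented_lift_gen. Qed.

Definition rho_entry (i j : 'I_3) (s : B4) : laurent := units_val (rho s) i j.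

Definition braid_a : B4 :=
  (sigma i1 * sigma i2 * (sigma i1)^-1 *
   sigma i3 * (sigma i2)^-1 * (sigma i1)^-1)%g.

Lemma rho_a :
  units_val (rho braid_a) = mx3 [:: [:: - t^-1 + 1; - t^-1 + t; - t^-1];
                                    [::          0;        - t;      0];
                                    [::        - 1;          0;      0]].
Proof.
have tK : t^-1 * t = 1 by rewrite mulVr ?t_unit.
rewrite /braid_a !gmulfM !gmulfV /= !rho_sigma /= !burau_mxV.
rewrite /burau_mx /burau_inv_mx /= !mx3M; congr (mx3 _);
  do ![congr (_ :: _)]; ring: tK.
Qed.

(* S_ i t and S_ i t^-1 are the sums S_i(t) and S_i(t^-1).                    *)
Definition S_ (i : nat) (x : laurent) : laurent := \sum_(0 <= k < i.+1) (- x) ^+ k.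

(* Main.v *)
Require Import Defs.
From HB Require Import structures.
From mathcomp Require Import all_boot all_order all_fingroup all_algebra.
From mathcomp Require Import boolp ring.
Import GRing.Theory.
Local Open Scope ring_scope.

(** Left multiplication by [rho braid_a] acts on the first column (x, y, z) of
    a Burau matrix with the three eigenvalues 1, - t^-1 and - t.  The entry y is
    multiplied by - t, and (1, 1, 1) is a left eigenvector for - t^-1, so that
    x + y + z is multiplied by - t^-1.  Hence the components of the column
    along the last two eigenvectors are governed by x + y + z and by y, and
    since a geometric sum [S_ m x] is an affine function of (- x) ^+ m, the
    decomposition must be the one with
      R = t^-1 y,   P = - t (x + y + z),   Q = - z - P - R.
    These are Laurent polynomials for every braid, so that n = 0 already works;
    the formulas for all m follow by induction ([burau_braid_a_iter]).
    Uniqueness comes from the entries at m = 0 and m = 1, which form a linear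
    system for (P, Q, R) whose determinant is, up to sign, t - t^-1, and this
    is nonzero ([decomposition_unique]).

    It remains to see that x + y + z is nonzero for a pure braid.  At t = 1 the
    generators, acting on row vectors, become the simple reflections of S_4 in
    the basis of the simple roots e_i - e_(i+1), so the representation factors
    through [braid_perm] ([burau_at1_perm]).  A pure braid is therefore sent to
    the identity matrix, whose first column has sum 1 ([pure_column_sum]). *)

(** * Laurent polynomials at t = 1 *)

Lemma laurent_fracP (x : laurent) :
  exists pk : {poly int} * nat,
    val x * FracField.tofrac 'X ^+ pk.2 = FracField.tofrac pk.1.
Proof.
case: x => x /= /asboolP[p [k ->]]; exists (p, k) => /=.
by rewrite divfK // expf_neq0 // tofracX_neq0.
Qed.

Definition laurent_at1 (x : laurent) : int :=
  (projT1 (cid (laurent_fracP x))).1.[1].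

(** The powers of X in the denominators all take the value 1, so the choice of
    the fraction is immaterial. *)
Lemma laurent_at1E (x : laurent) (p : {poly int}) (k : nat) :
  val x * FracField.tofrac 'X ^+ k = FracField.tofrac p -> laurent_at1 x = p.[1].
Proof.
rewrite /laurent_at1; case: cid => -[q l] /= xq xp.
have : q * 'X^k = p * 'X^l.
  apply/eqP; rewrite -tofrac_eq !tofracM !tofracXn -xq -xp.
  by rewrite mulrAC.
by move/(congr1 (horner^~ 1)); rewrite !hornerE !expr1n !mulr1.
Qed.

Lemma laurent_at1_is_zmod_morphism : zmod_morphism laurent_at1.
Proof.
move=> x y; have [[p k] /= xp] := laurent_fracP x.
have [[q l] /= yq] := laurent_fracP y.
rewrite (laurent_at1E _ _ _ xp) (laurent_at1E _ _ _ yq).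
rewrite (laurent_at1E _ (p * 'X^l - q * 'X^k) (k + l)%N).
  by rewrite !hornerE !expr1n !mulr1.
by rewrite tofracB !tofracM !tofracXn -xp -yq rmorphB exprD /=; ring.
Qed.

Lemma laurent_at1_is_monoid_morphism : monoid_morphism laurent_at1.
Proof.
split=> [|x y].
  rewrite (laurent_at1E _ 1 0); first by rewrite hornerE.
  by rewrite expr0 mulr1 tofrac1 rmorph1.
have [[p k] /= xp] := laurent_fracP x; have [[q l] /= yq] := laurent_fracP y.
rewrite (laurent_at1E _ _ _ xp) (laurent_at1E _ _ _ yq).
rewrite (laurent_at1E _ (p * q) (k + l)%N); first by rewrite hornerE.
by rewrite tofracM -xp -yq rmorphM exprD /=; ring.
Qed.

HB.instance Definition _ := GRing.isZmodMorphism.Build laurent int laurent_at1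
  laurent_at1_is_zmod_morphism.
HB.instance Definition _ := GRing.isMonoidMorphism.Build laurent int laurent_at1
  laurent_at1_is_monoid_morphism.

Lemma laurent_at1_tV : laurent_at1 t^-1 = 1.
Proof.
rewrite (laurent_at1E _ 1 1); first by rewrite hornerE.
by rewrite val_tV mulVf ?tofracX_neq0 ?tofrac1.
Qed.

Lemma t_neq0 : t != 0.
Proof. by apply: contraTneq t_unit => ->; rewrite unitr0. Qed.

Lemma t_neq_tV : t - t^-1 != 0.
Proof.
rewrite subr_eq0; apply/eqP => /(congr1 ( *%R t)); rewrite mulrV ?t_unit //.
move/(congr1 val)/eqP; rewrite rmorphM rmorph1 /= -tofracM -tofrac1 tofrac_eq.
move/eqP/(congr1 (horner^~ 2)).
by rewrite !hornerE.
Qed.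

(** * The Burau representation at t = 1 *)

Definition burau_at1 (s : B4) : 'M[int]_3 :=
  map_mx laurent_at1 (units_val (rho s)).

(** The rows are the simple roots e_i - e_(i+1) of S_4. *)
Definition roots_mx : 'M[int]_(3, 4) :=
  \matrix_(i, j) ((j == i :> nat)%:R - (j == i.+1 :> nat)%:R).

(** The columns are the fundamental weights e_0 + ... + e_j, dual to the simple
    roots. *)
Definition weights_mx : 'M[int]_(4, 3) := \matrix_(i, j) (i <= j)%N%:R.

Lemma roots_weights_mx : roots_mx *m weights_mx = 1%:M.
Proof.
apply/matrixP => i j; rewrite !mxE !big_ord_recl big_ord0 !mxE.
by case: i j => [[|[|[|//]]] ?] [[|[|[|//]]] ?].
Qed.

Lemma burau_at1_sigma (i : 'I_3) :
  burau_at1 (sigma i) *m roots_mx = roots_mx *m perm_mx (adj_tperm i).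
Proof.
rewrite /burau_at1 rho_sigma /= -[adj_tperm i]invgK -col_permE.
apply/matrixP => k j; rewrite tpermV !mxE !big_ord_recl big_ord0 !mxE permE /=.
have tVN : laurent_at1 (- t^-1) = -1 by rewrite rmorphN [X in - X]laurent_at1_tV.
have at1_0 : laurent_at1 0 = 0 by exact: rmorph0.
have at1_1 : laurent_at1 1 = 1 by exact: rmorph1.
rewrite /burau_mx.
by case: i k j => [[|[|[|//]]] ?] [[|[|[|//]]] ?] [[|[|[|[|//]]]] ?];
  rewrite !mxE /= ?(tVN, at1_0, at1_1, laurent_at1_tV).
Qed.

Lemma burau_at1M (r s : B4) : burau_at1 (r * s)%g = burau_at1 r *m burau_at1 s.
Proof. by rewrite /burau_at1 gmulfM map_mxM. Qed.

Lemma burau_at1_1 : burau_at1 1%g = 1%:M.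
Proof. by rewrite /burau_at1 gmulf1 map_mx1. Qed.

Lemma B4_ind (C : B4 -> Prop) :
    C 1%g -> (forall r s, C r -> C s -> C (r * s)%g) ->
    (forall s, C s -> C s^-1%g) -> (forall i, C (sigma i)) ->
  forall s, C s.
Proof.
move=> C1 CM CV Cg s; rewrite -[s]repr_word_classK.
elim: (generic_quotient.repr s) => [//|[i b] w IHw].
rewrite -[_ :: w]/([:: (i, b)] ++ w) -word_classM; apply: CM => //.
case: b; last exact: Cg.
have -> : word_class braid_rel [:: (i, true)] = (sigma i)^-1%g :> B4.
  apply: (mulIg (sigma i)); rewrite mulVg.
  apply: etrans (word_classM braid_rel [:: (i, true)] [:: (i, false)]) _.
  by apply/word_classP; exact: (weq_cancel _ (i, true)).
exact/CV/Cg.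
Qed.

(** The matrix of roots intertwines the representation at t = 1 with the
    permutation representation; it has a right inverse but is not square, hence
    the two-sided form. *)
Lemma burau_at1_perm (s : B4) :
  burau_at1 s *m roots_mx = roots_mx *m perm_mx (braid_perm s).
Proof.
elim/B4_ind: s => [|r s IHr IHs|s IHs|i].
- by rewrite burau_at1_1 gmulf1 perm_mx1 mul1mx mulmx1.
- by rewrite burau_at1M gmulfM perm_mxM -mulmxA IHs mulmxA IHr mulmxA.
- have VK : burau_at1 s^-1%g *m burau_at1 s = 1%:M.
    by rewrite -burau_at1M mulVg burau_at1_1.
  have KV : perm_mx (braid_perm s) *m perm_mx (braid_perm s^-1%g) = 1%:M :> 'M[int]_4.
    by rewrite -perm_mxM -gmulfM mulgV gmulf1 perm_mx1.
  rewrite -[LHS]mulmx1 -KV mulmxA -(mulmxA (burau_at1 _)) -IHs.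
  by rewrite mulmxA VK mul1mx.
- by rewrite braid_perm_sigma burau_at1_sigma.
Qed.

Lemma pure_burau_at1 (s : B4) : pure s -> burau_at1 s = 1%:M.
Proof.
move=> ps; rewrite -[LHS]mulmx1 -roots_weights_mx mulmxA burau_at1_perm.
by rewrite ps perm_mx1 mulmx1.
Qed.

Lemma pure_column_sum (s : B4) : pure s ->
  rho_entry i1 i1 s + rho_entry i2 i1 s + rho_entry i3 i1 s != 0.
Proof.
move=> /pure_burau_at1 /matrixP s1; apply/eqP => /(congr1 laurent_at1).
rewrite !rmorphD rmorph0 /=.
by move: (s1 i1 i1) (s1 i2 i1) (s1 i3 i1); rewrite !mxE /rho_entry => -> -> ->.
Qed.

(** * The action of powers of a *)

Lemma S_0 (x : laurent) : S_ 0 x = 1.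
Proof. by rewrite /S_ big_nat1. Qed.

Lemma S_recr (m : nat) (x : laurent) : S_ m.+1 x = S_ m x + (- x) ^+ m.+1.
Proof. by rewrite /S_ big_nat_recr. Qed.

Lemma S_recl (m : nat) (x : laurent) : S_ m.+1 x = 1 - x * S_ m x.
Proof.
rewrite /S_ big_nat_recl // expr0 -mulNr big_distrr /=.
by under [in RHS]eq_bigr do rewrite -exprS.
Qed.

Lemma burau_braid_a (s : B4) :
  [/\ rho_entry i1 i1 (braid_a * s)%g =
        (1 - t^-1) * rho_entry i1 i1 s + (t - t^-1) * rho_entry i2 i1 s
        - t^-1 * rho_entry i3 i1 s,
      rho_entry i2 i1 (braid_a * s)%g = - t * rho_entry i2 i1 s &
      rho_entry i3 i1 (braid_a * s)%g = - rho_entry i1 i1 s].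
Proof.
rewrite /rho_entry gmulfM /= rho_a.
have E0 : ord0 = i1 by exact: val_inj.
have E1 : lift ord0 ord0 = i2 by exact: val_inj.
have E2 : lift ord0 (lift ord0 ord0) = i3 by exact: val_inj.
by split; rewrite !mxE !big_ord_recl big_ord0 !mxE /= E2 E1 E0; ring.
Qed.

Lemma burau_braid_a_iter (s : B4) (P Q R : laurent) (m : nat) :
    rho_entry i1 i1 s = P * (1 - t^-1) + Q + R * (1 - t) ->
    rho_entry i2 i1 s = t * R -> rho_entry i3 i1 s = - P - Q - R ->
  [/\ rho_entry i1 i1 (braid_a ^+ m * s)%g =
        P * S_ m.+1 t^-1 + Q + R * S_ m.+1 t,
      rho_entry i2 i1 (braid_a ^+ m * s)%g = - R * (- t) ^+ m.+1 &
      rho_entry i3 i1 (braid_a ^+ m * s)%g =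
        - P * S_ m t^-1 - Q - R * S_ m t].
Proof.
move=> Ex Ey Ez; elim: m => [|m [IHx IHy IHz]].
  by rewrite mul1g Ex Ey Ez !S_recr !S_0 !expr1; split; ring.
rewrite expgS -mulgA; have [-> -> ->] := burau_braid_a (braid_a ^+ m * s)%g.
rewrite {}IHx {}IHy {}IHz; split; last by ring.
- (* Expanding from the left turns the P-part into an identity between
     polynomials in S_m(t^-1); the R-part, which absorbs the contribution of
     the second row, needs the expansion from the right. *)
  by rewrite !(S_recl _ t^-1) !(S_recr _ t) (exprS _ m.+1); ring.
- by rewrite (exprS _ m.+1); ring.
Qed.

(** Eliminating q with the first equation leaves p t^-1 + r t = 0 and
    p t^-2 + r t^2 = 0, and t times the former minus the latter is
    p t^-1 (t - t^-1). *)
Lemma decomposition_unique (p q r : laurent) :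
    p + q + r = 0 -> p * S_ 1 t^-1 + q + r * S_ 1 t = 0 ->
    p * S_ 2 t^-1 + q + r * S_ 2 t = 0 ->
  [/\ p = 0, q = 0 & r = 0].
Proof.
rewrite !S_recr !S_0 => e0 e1 e2.
have Eq : q = - p - r by rewrite -[RHS]addr0 -[X in _ + X]e0; ring.
have d1 : p * t^-1 + r * t = 0 by apply: oppr_inj; rewrite oppr0 -[RHS]e1 Eq; ring.
have d2 : p * t^-1 ^+ 2 + r * t ^+ 2 = 0.
  by rewrite -[LHS](subrK (p * t^-1 + r * t)) {2}d1 addr0 -[RHS]e2 Eq; ring.
have p0 : p = 0.
  have : t * (p * t^-1 + r * t) - (p * t^-1 ^+ 2 + r * t ^+ 2) =
         p * t^-1 * (t - t^-1) by ring.
  rewrite d1 d2 mulr0 subr0 => /esym/eqP.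
  by rewrite !mulf_eq0 invr_eq0 (negPf t_neq0) (negPf t_neq_tV) !orbF => /eqP.
have r0 : r = 0.
  move/eqP: d1; rewrite p0 mul0r add0r mulf_eq0.
  by rewrite (negPf t_neq0) orbF => /eqP.
by move: e0; rewrite p0 r0 add0r addr0.
Qed.

Theorem lemma4p1 (s : B4) :
  exists (n : nat) (P Q R : laurent),
    let entries1 (P Q R : laurent) : Prop :=
      rho_entry i1 i1 (braid_a ^+ n * s)%g
        = P * (1 - t^-1) + Q + R * (1 - t) /\
      rho_entry i3 i1 (braid_a ^+ n * s)%g = - P - Q - R in
    let entries2 (P Q R : laurent) : Prop :=
      forall m : nat,
      rho_entry i1 i1 (braid_a ^+ (m + n) * s)%g
        = P * S_ m.+1 t^-1 + Q + R * S_ m.+1 t /\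
      rho_entry i3 i1 (braid_a ^+ (m + n) * s)%g
        = - P * S_ m t^-1 - Q - R * S_ m t in
    [/\ entries1 P Q R,
        entries2 P Q R,
        (forall P' Q' R' : laurent,
           entries1 P' Q' R' -> entries2 P' Q' R' ->
           [/\ P' = P, Q' = Q & R' = R]) &
        (pure s -> P != 0)].
Proof.
pose x := rho_entry i1 i1 s; pose y := rho_entry i2 i1 s.
pose z := rho_entry i3 i1 s.
pose P := - t * (x + y + z); pose R := t^-1 * y; pose Q := - z - P - R.
have tK : t^-1 * t = 1 by rewrite mulVr ?t_unit.
have Ex : x = P * (1 - t^-1) + Q + R * (1 - t) by rewrite /Q /R /P; ring: tK.
have Ey : y = t * R by rewrite /R; ring: tK.
have Ez : z = - P - Q - R by rewrite /Q; ring.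
have iter m := burau_braid_a_iter s P Q R m Ex Ey Ez.
exists 0%N, P, Q, R => entries1 entries2; split.
- by rewrite /entries1 mul1g.
- by move=> m; rewrite addn0; have [] := iter m.
- move=> P' Q' R' _ e'.
  have [x0 _ z0] := iter 0%N; have [x1 _ _] := iter 1%N.
  have [x0' z0'] := e' 0%N; have [x1' _] := e' 1%N.
  rewrite !addn0 in x0' z0' x1'.
  have [] := decomposition_unique (P' - P) (Q' - Q) (R' - R).
  + by rewrite -(subrr (rho_entry i3 i1 (braid_a ^+ 0 * s)%g)) {1}z0 z0' !S_0; ring.
  + by rewrite -(subrr (rho_entry i1 i1 (braid_a ^+ 0 * s)%g)) {1}x0' x0; ring.
  + by rewrite -(subrr (rho_entry i1 i1 (braid_a ^+ 1 * s)%g)) {1}x1' x1; ring.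
  + by move=> /subr0_eq -> /subr0_eq -> /subr0_eq ->.
- by move=> ps; rewrite /P mulf_eq0 oppr_eq0 (negPf t_neq0) pure_column_sum.
Qed.
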